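(* There is an absolute constant $C>0$ such that the following holds. Let $n_1,n_2,d_1,d_2,r$ be positive integers with $r\le d_1\le n_1$, $r\le d_2\le n_2$, and let $n=\max\{n_1,n_2\}$. Let $A\in\mathbb R^{n_1\times d_1}$ and $B\in\mathbb R^{n_2\times d_2}$ be $\mu$-incoherent isometries, and let $X^*\in\mathbb R^{n_1\times n_2}$ be a rank-$r$ matrix whose column space is contained in the span of the columns of $A$ and whose row space is contained in the span of the columns of $B$; write $X^*=AM^*B^\top$ with $M^*=A^\top X^*B\in\mathbb R^{d_1\times d_2}$ (of rank $r$). Let $\Omega\subseteq[n_1]\times[n_2]$ be drawn uniformly at random among all subsets of size $|\Omega|$, with $|\Omega|\ge C\mu^2 d_1d_2\log n$, and let $Y=\mathcal P_\Omega(X^* )$. Then, with probability at least $1-2n^{-2}$, every critical point $(U,V)$, $U\in\mathbb R^{d_1\times r}$, $V\in\mathbb R^{d_2\times r}$, of $$g(U,V)=\|\mathcal P_\Omega(AUV^\top B^\top)-Y\|_F^2$$ is either a global minimum with $UV^\top=M^*$, or a strict saddle point (a point at which the Hessian of $g$ has at least one strictly negative eigenvalue).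
   Context: A matrix $A\in\mathbb R^{n_1\times d_1}$ is an isometry if $A^\top A=I_{d_1}$. For a matrix $X$, $\|X\|_{2,\infty}$ denotes the largest Euclidean norm of a row of $X$. An isometry $A\in\mathbb R^{n_1\times d_1}$ is $\mu$-incoherent if $\|A\|_{2,\infty}\le\sqrt{\mu d_1/n_1}$ (equivalently, in the general definition: a rank-$k$ matrix with thin SVD $U\Sigma V^\top$ is $\mu$-incoherent if $\|U\|_{2,\infty}\le\sqrt{\mu k/n_1}$ and $\|V\|_{2,\infty}\le\sqrt{\mu k/n_2}$). $[n]=\{1,\dots,n\}$. The sampling operator $\mathcal P_\Omega:\mathbb R^{n_1\times n_2}\to\mathbb R^{n_1\times n_2}$ is defined by $[\mathcal P_\Omega(X)]_{ij}=X_{ij}$ if $(i,j)\in\Omega$ and $0$ otherwise. *)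

(* Defs.v *)
From HB Require Import structures.
From mathcomp Require Import all_boot all_order all_algebra.
From mathcomp Require Import all_classical all_reals all_analysis.
Set Implicit Arguments. Unset Strict Implicit. Unset Printing Implicit Defensive.
Import Order.TTheory GRing.Theory Num.Theory.
Local Open Scope ring_scope.

Section Defs.
Variable R : realType.

Definition row_norm m n (X : 'M[R]_(m, n)) (i : 'I_m) : R :=
  Num.sqrt (\sum_(j < n) X i j ^+ 2).

Definition norm2inf_le m n (X : 'M[R]_(m, n)) (b : R) : Prop :=
  forall i, row_norm X i <= b.

Definition isometry m n (A : 'M[R]_(m, n)) : Prop := A^T *m A = 1%:M.

Definition incoherent_isometry (mu : R) m d (A : 'M[R]_(m, d)) : Prop :=
  isometry A /\ norm2inf_le A (Num.sqrt (mu * d%:R / m%:R)).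

Definition P_Omega m n (Om : {set 'I_m * 'I_n}) (X : 'M[R]_(m, n)) : 'M[R]_(m, n) :=
  \matrix_(i, j) (if (i, j) \in Om then X i j else 0).

Definition frob2 m n (X : 'M[R]_(m, n)) : R := \sum_i \sum_j X i j ^+ 2.

Definition gobj n1 n2 d1 d2 r (Om : {set 'I_n1 * 'I_n2})
  (A : 'M[R]_(n1, d1)) (B : 'M[R]_(n2, d2)) (Y : 'M[R]_(n1, n2))
  (U : 'M[R]_(d1, r)) (V : 'M[R]_(d2, r)) : R :=
  frob2 (P_Omega Om (A *m U *m V^T *m B^T) - Y).

Definition gvec n1 n2 d1 d2 r (Om : {set 'I_n1 * 'I_n2})
  (A : 'M[R]_(n1, d1)) (B : 'M[R]_(n2, d2)) (Y : 'M[R]_(n1, n2))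
  (z : 'rV[R]_(d1 * r + d2 * r)) : R :=
  gobj Om A B Y (vec_mx (lsubmx z)) (vec_mx (rsubmx z)).

Definition UVvec d1 d2 r (U : 'M[R]_(d1, r)) (V : 'M[R]_(d2, r)) : 'rV[R]_(d1 * r + d2 * r) :=
  row_mx (mxvec U) (mxvec V).

Definition partial N (f : 'rV[R]_N -> R) (z : 'rV[R]_N) (i : 'I_N) : R :=
  derive1 (fun t : R => f (z + t *: delta_mx 0 i)) 0.

Definition gradient N (f : 'rV[R]_N -> R) (z : 'rV[R]_N) : 'rV[R]_N :=
  \row_i partial f z i.

Definition hessian N (f : 'rV[R]_N -> R) (z : 'rV[R]_N) : 'M[R]_N :=
  \matrix_(i, j) partial (fun w => partial f w j) z i.

Definition unif_subset_prob (T : finType) (m : nat) (P : {set T} -> Prop) : R :=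
  #|[set S : {set T} | (#|S| == m) && `[< P S >]]|%:R /
  #|[set S : {set T} | #|S| == m]|%:R.

End Defs.

(* Main.v *)
Require Import Defs.
From HB Require Import structures.
From mathcomp Require Import all_boot all_order all_algebra.
From mathcomp Require Import all_classical all_reals all_analysis.
From mathcomp Require Import ring lra zify.
From mathcomp.real_closed Require Import complex.
Import Order.TTheory GRing.Theory Num.Theory.
Local Open Scope ring_scope.
Set Implicit Arguments. Unset Strict Implicit. Unset Printing Implicit Defensive.

(* Write v_ij for the vectorisation of a_i^T b_j, with a_i and b_j the rows of A and B. The v_ij
form a tight frame, sum v_ij v_ij^T = 1, and by incoherence |v_ij|^2 <= K = mu^2 d1 d2 / (n1 n2).
With p = |Omega| / (n1 n2), the sampled Gram matrix of the v_ij is within p/4 of p in operator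
norm: for its deviation H, the trace of H^(2q) is estimated by the method of exchangeable pairs,
where one sampled index is exchanged for an unsampled one. This gives
E tr H^(2q+2) <= (L^2 + 4 p L) E tr H^(2q) with L = 2 (2q+1) K, and Markov's inequality with q of
the order of log n concludes.

On this event the landscape is deterministic. Let E = U V^T - M*, and let G be the gradient at E
of half the least-squares objective, so that G V = 0 and U^T G = 0 at a critical point. If the
Hessian has no negative eigenvalue, testing it on rank-one directions bounds the operator norm
of G by (5/4) p times the r-th singular value of X = U V^T. Hence X is a best rank-r
approximation of X - G / ((5/4) p) (Eckart-Young), and comparing it with M* gives
<G, E> <= (5/8) p |E|^2, whereas <G, E> >= (3/4) p |E|^2; so E = 0. *)

(** * The Frobenius inner product *)

Section FrobeniusInnerProduct.
Variable R : realFieldType.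

Definition fdot m n (X Y : 'M[R]_(m, n)) : R := \tr (X *m Y^T).

Lemma fdotE m n (X Y : 'M[R]_(m, n)) : fdot X Y = \sum_i \sum_j X i j * Y i j.
Proof.
apply: eq_bigr => i _; rewrite mxE; apply: eq_bigr => j _; by rewrite mxE.
Qed.

Lemma fdotC m n (X Y : 'M[R]_(m, n)) : fdot X Y = fdot Y X.
Proof. by rewrite /fdot -mxtrace_tr trmx_mul trmxK. Qed.

Lemma fdotDl m n (X Y Z : 'M[R]_(m, n)) : fdot (X + Y) Z = fdot X Z + fdot Y Z.
Proof. by rewrite /fdot mulmxDl mxtraceD. Qed.

Lemma fdotDr m n (X Y Z : 'M[R]_(m, n)) : fdot X (Y + Z) = fdot X Y + fdot X Z.
Proof. by rewrite fdotC fdotDl !(fdotC X). Qed.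

Lemma fdotZl m n a (X Y : 'M[R]_(m, n)) : fdot (a *: X) Y = a * fdot X Y.
Proof. by rewrite /fdot -scalemxAl mxtraceZ. Qed.

Lemma fdotZr m n a (X Y : 'M[R]_(m, n)) : fdot X (a *: Y) = a * fdot X Y.
Proof. by rewrite fdotC fdotZl fdotC. Qed.

Lemma fdotNl m n (X Y : 'M[R]_(m, n)) : fdot (- X) Y = - fdot X Y.
Proof. by rewrite -scaleN1r fdotZl mulN1r. Qed.

Lemma fdotNr m n (X Y : 'M[R]_(m, n)) : fdot X (- Y) = - fdot X Y.
Proof. by rewrite fdotC fdotNl fdotC. Qed.

Lemma fdot0l m n (X : 'M[R]_(m, n)) : fdot 0 X = 0.
Proof. by rewrite -(scale0r (0 : 'M[R]_(m, n))) fdotZl mul0r. Qed.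

Lemma fdot0r m n (X : 'M[R]_(m, n)) : fdot X 0 = 0.
Proof. by rewrite fdotC fdot0l. Qed.

Lemma fdot_suml (I : Type) (s : seq I) (P : pred I) m n (F : I -> 'M[R]_(m, n)) Y :
  fdot (\sum_(i <- s | P i) F i) Y = \sum_(i <- s | P i) fdot (F i) Y.
Proof. by apply: (big_morph (fun X => fdot X Y)) => [X Z|]; rewrite ?fdotDl ?fdot0l. Qed.

Lemma fdot_ge0 m n (X : 'M[R]_(m, n)) : 0 <= fdot X X.
Proof.
by rewrite fdotE; apply: sumr_ge0 => i _; apply: sumr_ge0 => j _; rewrite -expr2 sqr_ge0.
Qed.

Lemma fdot_eq0 m n (X : 'M[R]_(m, n)) : (fdot X X == 0) = (X == 0).
Proof.
apply/eqP/eqP => [|->]; last exact: fdot0l.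
rewrite fdotE => X0; apply/matrixP => i j; rewrite mxE; apply/eqP.
rewrite -[_ == 0]orbb -mulf_eq0.
have X0i : \sum_j X i j * X i j = 0.
  apply/eqP; move/eqP: X0; rewrite psumr_eq0 => [/allP/(_ i)|k _].
    by rewrite mem_index_enum; apply.
  by apply: sumr_ge0 => l _; rewrite -expr2 sqr_ge0.
move/eqP: X0i; rewrite psumr_eq0 => [/allP/(_ j)|l _]; last by rewrite -expr2 sqr_ge0.
by rewrite mem_index_enum; apply.
Qed.

Lemma fdot_gt0 m n (X : 'M[R]_(m, n)) : (0 < fdot X X) = (X != 0).
Proof. by rewrite lt0r fdot_ge0 andbT fdot_eq0. Qed.

Lemma fdot_mull m n k (X : 'M[R]_(m, n)) (Y : 'M[R]_(n, k)) (Z : 'M[R]_(m, k)) :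
  fdot (X *m Y) Z = fdot Y (X^T *m Z).
Proof. by rewrite /fdot trmx_mul trmxK -mulmxA mxtrace_mulC mulmxA. Qed.

Lemma fdot_mulr m n k (X : 'M[R]_(m, n)) (Y : 'M[R]_(n, k)) (Z : 'M[R]_(m, k)) :
  fdot (X *m Y) Z = fdot X (Z *m Y^T).
Proof. by rewrite /fdot trmx_mul trmxK mulmxA. Qed.

Lemma fdot_tr m n (X Y : 'M[R]_(m, n)) : fdot X^T Y^T = fdot X Y.
Proof. by rewrite /fdot trmxK mxtrace_mulC -/(fdot Y X) fdotC. Qed.

Lemma fdotD2 m n (X Y : 'M[R]_(m, n)) :
  fdot (X + Y) (X + Y) = fdot X X + 2 * fdot X Y + fdot Y Y.
Proof. by rewrite fdotDl !fdotDr (fdotC Y X); ring. Qed.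

Lemma fdot_le_half m n (X Y : 'M[R]_(m, n)) : 2 * fdot X Y <= fdot X X + fdot Y Y.
Proof. by have := fdot_ge0 (X - Y); rewrite fdotD2 fdotNr fdotNl fdotNr; lra. Qed.

Lemma fdot_sqrD m n (X Y : 'M[R]_(m, n)) :
  fdot (X - Y) (X - Y) <= 2 * fdot X X + 2 * fdot Y Y.
Proof. by have := fdot_ge0 (X + Y); rewrite !fdotD2 fdotNr fdotNl fdotNr; lra. Qed.

Lemma fdot_CS m n (X Y : 'M[R]_(m, n)) : fdot X Y ^+ 2 <= fdot X X * fdot Y Y.
Proof.
have [->|Y0] := eqVneq Y 0; first by rewrite !fdot0r expr0n mulr0.
have Yp : 0 < fdot Y Y by rewrite fdot_gt0.
have := fdot_ge0 (fdot Y Y *: X - fdot X Y *: Y).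
rewrite fdotD2 !(fdotNr, fdotNl, fdotZl, fdotZr) => H.
rewrite -subr_ge0 -(pmulr_rge0 _ Yp); move: H; congr (0 <= _); ring.
Qed.

(** Cauchy-Schwarz on each entry of the product, a row of [X] against a column of [Y]. *)
Lemma fdot_mulmx_le m n k (X : 'M[R]_(m, n)) (Y : 'M[R]_(n, k)) :
  fdot (X *m Y) (X *m Y) <= fdot X X * fdot Y Y.
Proof.
have eX : fdot X X = \sum_i fdot (row i X) (row i X).
  rewrite fdotE; apply: eq_bigr => i _; rewrite fdotE big_ord1.
  by apply: eq_bigr => j _; rewrite !mxE.
have eY : fdot Y Y = \sum_j fdot (col j Y)^T (col j Y)^T.
  rewrite fdotE exchange_big; apply: eq_bigr => j _; rewrite fdotE big_ord1.
  by apply: eq_bigr => i _; rewrite !mxE.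
rewrite eX eY fdotE mulr_suml; apply: ler_sum => i _.
rewrite mulr_sumr; apply: ler_sum => j _.
suff -> : (X *m Y) i j = fdot (row i X) (col j Y)^T by rewrite -expr2 fdot_CS.
by rewrite fdotE big_ord1 mxE; apply: eq_bigr => l _; rewrite !mxE.
Qed.

Lemma mulmx_tr_col m (x y : 'cV[R]_m) : x^T *m y = (fdot x y)%:M.
Proof.
apply/matrixP => i j; rewrite !ord1 !mxE eqxx mulr1n fdotE.
by apply: eq_bigr => k _; rewrite big_ord1 mxE.
Qed.

Lemma fdot_outer m n k (P : 'M[R]_(m, n)) (x : 'cV[R]_n) (y : 'cV[R]_k) :
  fdot (P *m x *m y^T) (P *m x *m y^T) = fdot (P *m x) (P *m x) * fdot y y.
Proof.
rewrite fdot_mulr trmxK -mulmxA mulmx_tr_col mul_mx_scalar fdotZr mulrC; ring.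
Qed.

Lemma trmx_expr_sym n (A : 'M[R]_n) k : A^T = A -> (A ^+ k)^T = A ^+ k.
Proof.
move=> sA; elim: k => [|k IH]; first by rewrite expr0 trmx1.
by rewrite [in LHS]exprS trmx_mul sA IH exprSr.
Qed.

End FrobeniusInnerProduct.

(** * A mean value inequality for traces of odd powers *)

Section MeanValueTrace.
Variable R : realFieldType.

(** Maximum principle by induction on [n]: convexity at the last inner point keeps [f n] below the
    new maximum. *)
Lemma midconvex_le_max (f : nat -> R) n :
  (forall i, (0 < i < n)%N -> 2 * f i <= f i.-1 + f i.+1) ->
  forall i, (i <= n)%N -> f i <= Num.max (f 0%N) (f n).
Proof.
elim: n => [|n IH] cvx i; first by rewrite leqn0 => /eqP->; rewrite le_max lexx.
have {}IH j : (j <= n)%N -> f j <= Num.max (f 0%N) (f n).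
  by apply: IH => k /andP[k0 kn]; apply: cvx; rewrite k0 ltnS ltnW.
have fn : f n <= Num.max (f 0%N) (f n.+1).
  case: n IH cvx => [|n] IH cvx; first by rewrite le_max lexx.
  have := cvx n.+1 (ltnSn _); have := IH n (leqnSn _).
  rewrite !le_max /=; case: (leP (f n.+1) (f 0%N)) => //= H3 /orP[] H1 H2; lra.
rewrite leq_eqVlt => /orP[/eqP->|]; first by rewrite le_max lexx orbT.
rewrite ltnS => /IH; rewrite {1}le_max => /orP[H|H]; last exact: le_trans fn.
by rewrite le_max H.
Qed.

Variables (n : nat) (A B C : 'M[R]_n).
Hypotheses (sA : A^T = A) (sB : B^T = B).

Let phi i j := fdot (A ^+ i *m C *m B ^+ j) (A ^+ i *m C *m B ^+ j).

(** Symmetric powers cross the inner product, so the exponents on each side can be split at will. *)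
Lemma fdot_sandwich i j i' j' :
  fdot (A ^+ (i + i') *m C *m B ^+ (j + j')) C =
  fdot (A ^+ i *m C *m B ^+ j) (A ^+ i' *m C *m B ^+ j').
Proof.
have -> : A ^+ (i + i') = A ^+ i' *m A ^+ i by rewrite addnC exprD.
rewrite exprD -[B ^+ j * _]/(B ^+ j *m _) !mulmxA fdot_mulr.
by rewrite -!mulmxA fdot_mull !trmx_expr_sym.
Qed.

(* The sandwiched traces are midpoint convex in [k] along the even exponents, by Cauchy-Schwarz. *)
Lemma fdot_sandwich_le k l a : (k + l = a.*2)%N ->
  fdot (A ^+ k *m C *m B ^+ l) C <= phi a 0 + phi 0 a.
Proof.
have phiM i : (i <= a)%N -> phi i (a - i) <= phi a 0 + phi 0 a.
  move=> ia; apply: (@le_trans _ _ (Num.max (phi 0 (a - 0)) (phi a (a - a)))).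
    apply: (midconvex_le_max (f := fun i => phi i (a - i))) ia => -[//|j] /andP[_ ja] /=.
    have -> : phi j.+1 (a - j.+1) =
        fdot (A ^+ j *m C *m B ^+ (a - j)) (A ^+ j.+2 *m C *m B ^+ (a - j.+2)).
      by rewrite /phi -!fdot_sandwich; congr (fdot (A ^+ _ *m C *m B ^+ _) C); lia.
    exact: fdot_le_half.
  by rewrite subn0 subnn ge_max lerDl lerDr !fdot_ge0.
(* For even [k] the trace is a value of [phi]; for odd [k] it pairs two matrices whose squared norms
   are neighbouring values of [phi]. *)
move=> kl; have := odd_double_half k; case: (odd k) => /= Hk.
  have [k2 k2'] : (k./2 <= a)%N /\ (k./2.+1 <= a)%N by lia.
  have -> : fdot (A ^+ k *m C *m B ^+ l) C =
      fdot (A ^+ k./2 *m C *m B ^+ (a - k./2)) (A ^+ k./2.+1 *m C *m B ^+ (a - k./2.+1)).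
    by rewrite -fdot_sandwich; congr (fdot (A ^+ _ *m C *m B ^+ _) C); lia.
  have := phiM _ k2; have := phiM _ k2'.
  have := fdot_le_half (A ^+ k./2 *m C *m B ^+ (a - k./2))
    (A ^+ k./2.+1 *m C *m B ^+ (a - k./2.+1)).
  by rewrite -/(phi _ _) -/(phi _ _); lra.
have k2 : (k./2 <= a)%N by lia.
suff -> : fdot (A ^+ k *m C *m B ^+ l) C = phi k./2 (a - k./2) by exact: phiM.
by rewrite /phi -fdot_sandwich; congr (fdot (A ^+ _ *m C *m B ^+ _) C); lia.
Qed.

End MeanValueTrace.

(** The difference of powers telescopes into [a.*2.+1] sandwiches of [A - B] between powers of [A]
    and [B]; paired with [A - B], each is controlled by the two extreme ones. *)
Lemma mean_value_trace (R : realFieldType) n (A B : 'M[R]_n) a : A^T = A -> B^T = B ->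
  fdot (A ^+ a.*2.+1 - B ^+ a.*2.+1) (A - B) <=
  a.*2.+1%:R * (fdot (A ^+ a *m (A - B)) (A ^+ a *m (A - B)) +
                fdot (B ^+ a *m (A - B)) (B ^+ a *m (A - B))).
Proof.
move=> sA sB; set C := A - B; set s := a.*2.
have -> : A ^+ s.+1 - B ^+ s.+1 = \sum_(0 <= k < s.+1) A ^+ k *m C *m B ^+ (s - k).
  rewrite -[X in X - _]mulr1 -[X in _ - X]mul1r.
  rewrite -[1 in X in X - _](expr0 B) -[1 in X in _ - X](expr0 A).
  rewrite -{1}(subnn s.+1) -{2}(subn0 s.+1).
  rewrite -(telescope_sumr (fun k => A ^+ k * B ^+ (s.+1 - k))) //.
  rewrite !big_mkord; apply: eq_bigr => k _; have ks := ltn_ord k.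
  rewrite subSS (subSn (ks : (k <= s)%N)) /C mulmxBr mulmxBl; congr (_ - _).
    by rewrite exprSr.
  by rewrite exprS mulrA.
rewrite fdot_suml big_mkord mulr_natl -[X in _ *+ X]card_ord -sumr_const.
apply: ler_sum => k _; have ks := ltn_ord k.
have := @fdot_sandwich_le R n A B C sA sB k (s - k) a.
rewrite !expr0 !mulmx1 !mul1mx => H; apply: le_trans (H _) _; first by lia.
rewrite lerD2l -(fdot_tr (C *m _)) trmx_mul trmx_expr_sym // /C linearB /= sA sB.
exact: lexx.
Qed.

(** * Concentration of the sampled Gram matrix *)

(** Bounds the operator norm by the trace of an even power without diagonalising: by Cauchy-Schwarz
    the squared norms of [A ^+ i *m x] are log-convex in [i], so their successive ratios are at
    least the first one. *)
Lemma fdot_iter_le (R : realFieldType) n (A : 'M[R]_n) (x : 'cV[R]_n) k : A^T = A ->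
  fdot (A *m x) (A *m x) ^+ k.+1 <= fdot (A ^+ k.+1) (A ^+ k.+1) * fdot x x ^+ k.+1.
Proof.
move=> sA; pose a k := fdot (A ^+ k *m x) (A ^+ k *m x).
have a0 i : 0 <= a i by exact: fdot_ge0.
have a_cvx i : a i.+1 ^+ 2 <= a i * a i.+2.
  suff -> : a i.+1 = fdot (A ^+ i *m x) (A ^+ i.+2 *m x) by exact: fdot_CS.
  by rewrite {1}/a exprS -[_ * _]/(_ *m _) -mulmxA fdot_mull sA !mulmxA
    -[A *m A *m _]/(A * A * _) -mulrA -!exprS.
have a_ratio i : a 1%N * a i <= a 0%N * a i.+1.
  elim: i => [|i IH]; first by rewrite mulrC.
  have [->|ai0] := eqVneq (a i.+1) 0; first by rewrite mulr0 mulr_ge0.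
  have aip : 0 < a i.+1 by rewrite lt0r ai0 a0.
  rewrite -(ler_pM2r aip) -mulrA -expr2.
  apply: le_trans (ler_wpM2l (a0 _) (a_cvx i)) _.
  rewrite mulrA; apply: le_trans (ler_wpM2r (a0 _) IH) _.
  by rewrite -!mulrA (mulrC (a i.+1)).
have a1k i : a 1%N ^+ i <= (if i is j.+1 then a i * a 0%N ^+ j else 1).
  elim: i => [|[|i] IH]; rewrite ?expr0 ?expr1 ?mulr1 //.
  rewrite exprS; apply: le_trans (ler_wpM2l (a0 _) IH) _; rewrite exprS.
  by have := ler_wpM2r (exprn_ge0 i (a0 0%N)) (a_ratio i.+1); lra.
have E1 : fdot (A *m x) (A *m x) = a 1%N by rewrite /a expr1.
have E0 : fdot x x = a 0%N by rewrite /a expr0 mul1mx.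
rewrite E1 E0; apply: le_trans (a1k k.+1) _.
rewrite [X in _ <= _ * X]exprS mulrA; apply: ler_wpM2r; first exact: exprn_ge0.
by rewrite -E0; exact: fdot_mulmx_le.
Qed.

(** * Exchanging a sampled index for an unsampled one *)

Definition swap (T : finType) (S : {set T}) (i j : T) := j |: (S :\ i).

Lemma swapK (T : finType) (S : {set T}) i j : i \in S -> j \notin S ->
  swap (swap S i j) j i = S.
Proof.
move=> iS jS; apply/setP => x; rewrite !inE.
have [->|xi] := eqVneq x i; first by rewrite iS.
have [->|xj] := eqVneq x j; first by rewrite (negbTE jS).
by [].
Qed.

Lemma card_swap (T : finType) (S : {set T}) i j : i \in S -> j \notin S ->
  #|swap S i j| = #|S|.
Proof.
by move=> iS jS; rewrite cardsU1 !inE (negbTE jS) andbF (cardsD1 i S) iS.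
Qed.

(** Exchangeability: [(S, i, j) -> (swap S i j, j, i)] is an involution of the triples summed
    over. *)
Lemma swap_sum (R : realFieldType) (T : finType) (m : nat) (F : {set T} -> T -> T -> R) :
  \sum_(S : {set T} | #|S| == m) \sum_(i in S) \sum_(j in ~: S) F S i j =
  \sum_(S : {set T} | #|S| == m) \sum_(i in S) \sum_(j in ~: S) F (swap S i j) j i.
Proof.
rewrite !pair_big_dep /=.
pose h (x : {set T} * T * T) := (swap x.1.1 x.1.2 x.2, x.2, x.1.2).
pose P (x : {set T} * T * T) := (#|x.1.1| == m) && (x.1.2 \in x.1.1) && (x.2 \in ~: x.1.1).
have hP x : P x -> P (h x) && (h (h x) == x).
  case: x => [[S i] j]; rewrite /P /h /= !inE => /andP[/andP[mS iS] jS].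
  by rewrite card_swap // mS eqxx swapK //= !eqxx orbF andbT; apply: contraNneq jS => <-.
rewrite (reindex_onto h h) /=; last by move=> x /hP /andP[_ /eqP].
apply: eq_bigl => x; rewrite -[LHS]/(P (h x) && (h (h x) == x)) -[RHS]/(P x).
apply/idP/idP => [/andP[/hP /andP[Px _] /eqP hx]|/hP //].
by rewrite hx in Px.
Qed.

Section SampledGram.
Variables (R : realFieldType) (T : finType) (D m : nat).
Variables (v : T -> 'cV[R]_D) (K : R).
Hypothesis v_tight : \sum_e v e *m (v e)^T = 1%:M.
Hypothesis v_bound : forall e, fdot (v e) (v e) <= K.

Definition gram (S : {set T}) : 'M[R]_D := \sum_(e in S) v e *m (v e)^T.
(** Centred at the mean of [gram] over the [m]-subsets: each index is drawn with probability
    [m / #|T|], and the frame is tight. *)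
Definition dev (S : {set T}) : 'M[R]_D := gram S - (m%:R / #|T|%:R)%:M.

Let w e := v e *m (v e)^T.
Let N : R := #|T|%:R.
Let p : R := m%:R / N.

Lemma gramC S : gram (~: S) = 1%:M - gram S.
Proof.
rewrite -v_tight (bigID (mem S)) /= /gram addrC addrK.
by apply: eq_bigl => e; rewrite inE.
Qed.

Lemma gram_sym S : (gram S)^T = gram S.
Proof.
rewrite /gram linear_sum; apply: eq_bigr => e _ /=.
by rewrite trmx_mul trmxK.
Qed.

Lemma dev_sym S : (dev S)^T = dev S.
Proof. by rewrite /dev linearB /= gram_sym tr_scalar_mx. Qed.

Lemma gram_swap (S : {set T}) i j : i \in S -> j \notin S -> gram S - gram (swap S i j) = w i - w j.
Proof.
move=> iS jS; rewrite /gram (big_setD1 i iS) /= big_setU1 ?inE ?(negbTE jS) ?andbF //=.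
by rewrite opprD addrACA subrr addr0.
Qed.

Hypothesis N0 : (0 < #|T|)%N.

(** The linearity condition of the method of exchangeable pairs. The sum is
    [(N - m) gram S - m gram (~: S)], and tightness makes the second Gram matrix [1 - gram S]. *)
Lemma sum_swaps (S : {set T}) : #|S| = m ->
  \sum_(i in S) \sum_(j in ~: S) (w i - w j) = N *: dev S.
Proof.
move=> mS.
have NE : N = m%:R + #|~: S|%:R by rewrite -natrD -mS cardsC.
under eq_bigr do rewrite sumrB sumr_const -/(gram (~: S)) gramC.
rewrite sumrB sumr_const mS sumrMnl -/(gram S) /dev -/N.
rewrite scalerBr scale_scalar_mx mulrC divfK ?pnatr_eq0 -?lt0n //.
rewrite NE scalerDl -!scaler_nat scalerBr scalemx1 opprB addrA.
by rewrite [X in X - _ = _]addrC.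
Qed.

Lemma fdot_mul_rank1 (P : 'M[R]_D) i :
  fdot (P *m w i) (P *m w i) <= K * fdot (P *m w i) P.
Proof.
rewrite /w mulmxA fdot_outer [X in _ <= _ * X]fdot_mulr trmxK mulrC.
by apply: ler_wpM2r; [exact: fdot_ge0|exact: v_bound].
Qed.

Let M q := \sum_(S : {set T} | #|S| == m) fdot (dev S ^+ q) (dev S ^+ q).

Lemma bound_ge0 : 0 <= K.
Proof. by case/card_gt0P: N0 => e _; exact: le_trans (fdot_ge0 _) (v_bound e). Qed.

(** The conditional variance of an exchange, weighted by [P]. As [w i] has rank one, the squared
    norm of [P *m w i] is at most [K * x i], and tightness relates the sums of [x] over [S] and its
    complement. *)
Lemma sum_swaps_le (P : 'M[R]_D) (S : {set T}) : #|S| = m ->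
  \sum_(i in S) \sum_(j in ~: S) fdot (P *m (w i - w j)) (P *m (w i - w j)) <=
  2 * K * N * (fdot (P *m dev S) P + 2 * p * fdot P P).
Proof.
move=> mS; have K0 := bound_ge0.
pose x i := fdot (P *m w i) P.
have NE : N = m%:R + #|~: S|%:R by rewrite -natrD -mS cardsC.
have xD : \sum_(i in S) x i = fdot (P *m gram S) P.
  by rewrite /gram mulmx_sumr fdot_suml.
have xC : \sum_(j in ~: S) x j = fdot P P - fdot (P *m gram S) P.
  rewrite -[in LHS]/(x _) -fdotNl -[X in fdot X P + _]mulmx1 -fdotDl -mulmxN -mulmxDr -gramC.
  by rewrite /gram mulmx_sumr fdot_suml.
have x0 : 0 <= fdot (P *m gram S) P.
  rewrite -xD; apply: sumr_ge0 => i _; rewrite /x /w mulmxA fdot_mulr trmxK.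
  exact: fdot_ge0.
have xdev : fdot (P *m gram S) P = fdot (P *m dev S) P + p * fdot P P.
  by rewrite /dev mulmxBr fdotDl fdotNl mul_mx_scalar fdotZl -/N -/p subrK.
apply: (@le_trans _ _ (\sum_(i in S) \sum_(j in ~: S) (2 * K * x i + 2 * K * x j))).
  apply: ler_sum => i _; apply: ler_sum => j _; rewrite mulmxBr.
  apply: le_trans (fdot_sqrD _ _) _.
  have := fdot_mul_rank1 P i; have := fdot_mul_rank1 P j.
  by rewrite -/(x i) -/(x j); lra.
under eq_bigr do rewrite big_split /= sumr_const -mulr_sumr xC.
rewrite big_split /= sumr_const mS sumrMnl -mulr_sumr xD -[X in X + _]mulr_natr -[X in _ + X]mulr_natl.
have mp : m%:R = p * N by rewrite /p divfK // pnatr_eq0 -lt0n.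
set y := fdot (P *m gram S) P in x0 xdev *.
have -> : fdot (P *m dev S) P = y - p * fdot P P by rewrite xdev addrK.
have NmE : #|~: S|%:R = N - m%:R :> R by rewrite NE addrC addKr.
have m0 : 0 <= m%:R :> R by [].
(* The two sides differ by exactly [4 * m%:R * K * y], which is discarded. *)
have := mulr_ge0 (mulr_ge0 m0 K0) x0.
by rewrite NmE mp; lra.
Qed.

Lemma moment_step q L : L = 2 * q.*2.+1%:R * K ->
  M q.+1 <= (L ^+ 2 + 4 * p * L) * M q.
Proof.
move=> LE; have Np : 0 < N by rewrite ltr0n.
have K0 := bound_ge0.
pose C i j := w i - w j.
have CS (S : {set T}) i j : i \in S -> j \in ~: S -> dev S - dev (swap S i j) = C i j.
  by rewrite inE => iS jS; rewrite /dev opprB addrA subrK gram_swap.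
pose Z F := \sum_(S : {set T} | #|S| == m) \sum_(i in S) \sum_(j in ~: S) F S i j : R.
(* [sum_swaps] trades one factor [dev S] of the trace for a sum over exchanges. *)
have ZE : N * M q.+1 = Z (fun S i j => fdot (dev S ^+ q.*2.+1) (C i j)).
  rewrite mulr_sumr; apply: eq_bigr => S /eqP mS.
  under eq_bigr => i _.
    under eq_bigr => j _ do rewrite fdotC.
    rewrite -fdot_suml; over.
  rewrite -fdot_suml sum_swaps // fdotZl; congr (_ * _).
  rewrite [in LHS]exprS -[_ * _]/(_ *m _) fdot_mulr trmx_expr_sym ?dev_sym //.
  rewrite -[X in fdot _ X]/(dev S * dev S ^+ q * dev S ^+ q).
  by rewrite -mulrA -exprD -exprS addnn.
(* Adding the swapped copy of the sum produces the difference of the odd powers at [S] and at its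
   swap, where [mean_value_trace] applies; swapping back merges the two resulting squares. *)
have Zle : 2 * (N * M q.+1) <=
    q.*2.+1%:R * (2 * Z (fun S i j => fdot (dev S ^+ q *m C i j) (dev S ^+ q *m C i j))).
  rewrite ZE mulr_natl [X in X <= _]mulr2n {2}/Z swap_sum -/(Z _).
  rewrite [X in _ <= _ * X]mulr_natl mulr2n [X in _ <= _ * (_ + X)]/Z swap_sum.
  rewrite -!big_split mulr_sumr /=; apply: ler_sum => S _.
  rewrite -!big_split mulr_sumr /=; apply: ler_sum => i iS.
  rewrite -!big_split mulr_sumr /=; apply: ler_sum => j jS.
  have -> : C j i = - C i j by rewrite /C opprB.
  have := mean_value_trace q (dev_sym S) (dev_sym (swap S i j)).
  by rewrite CS // fdotDl !fdotNl !mulmxN fdotNl !fdotNr opprK.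
have {}Zle : N * M q.+1 <= L * N *
    \sum_(S : {set T} | #|S| == m)
       (fdot (dev S ^+ q *m dev S) (dev S ^+ q) + 2 * p * fdot (dev S ^+ q) (dev S ^+ q)).
  rewrite -(ler_pM2l (ltr0n R 2)); apply: le_trans Zle _.
  rewrite mulrCA ler_pM2l ?ltr0n //.
  have -> : L * N = q.*2.+1%:R * (2 * K * N) by rewrite LE; ring.
  rewrite -mulrA ler_pM2l ?ltr0n // mulr_sumr.
  by apply: ler_sum => S /eqP mS; exact: sum_swaps_le.
have Mle : M q.+1 <= L *
    \sum_(S : {set T} | #|S| == m)
       (fdot (dev S ^+ q *m dev S) (dev S ^+ q) + 2 * p * fdot (dev S ^+ q) (dev S ^+ q)).
  by rewrite -(ler_pM2l Np) mulrCA mulrA.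
(* The remaining odd trace is split by 2ab <= a^2 + b^2 between [M q.+1], absorbed on the left, and
   [L ^+ 2 * M q]. *)
suff : 2 * M q.+1 <= M q.+1 + (L ^+ 2 + 4 * p * L) * M q by lra.
apply: le_trans (ler_wpM2l (ler0n _ 2) Mle) _.
rewrite /M !mulr_sumr -big_split /=; apply: ler_sum => S _.
rewrite -[dev S ^+ q *m dev S]/(dev S ^+ q * dev S) -exprSr.
have := fdot_le_half (dev S ^+ q.+1) (L *: dev S ^+ q).
by rewrite !fdotZr fdotZl; lra.
Qed.

(** Iterates [moment_step] with [L <= eta * p] at every stage, from a zeroth moment of [D] per
    subset. *)
Lemma moment_bound q (eta : R) : (forall k, (k < q)%N -> 2 * k.*2.+1%:R * K <= eta * p) ->
  M q <= ((eta ^+ 2 + 4 * eta) * p ^+ 2) ^+ q * (#|[set S : {set T} | #|S| == m]|%:R * D%:R).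
Proof.
elim: q => [|q IH] Hq.
  rewrite expr0 mul1r /M.
  under eq_bigr => S _.
    rewrite expr0 /fdot trmx1 mulmx1 mxtrace1; over.
  by rewrite sumr_const cardsE mulr_natl.
have K0 := bound_ge0; have p0 : 0 <= p by rewrite divr_ge0.
have Lq := Hq q (ltnSn _); have L0 : 0 <= 2 * q.*2.+1%:R * K by rewrite !mulr_ge0.
apply: le_trans (moment_step (erefl _)) _; move: Lq L0; set L := (2 * _ * K) => Lq L0.
rewrite [X in _ <= X * _]exprS -[X in _ <= X]mulrA; apply: ler_pM.
- by rewrite addr_ge0 ?sqr_ge0 // mulr_ge0 // mulr_ge0.
- by apply: sumr_ge0 => S _; exact: fdot_ge0.
- have -> : (eta ^+ 2 + 4 * eta) * p ^+ 2 = (eta * p) ^+ 2 + 4 * p * (eta * p) by ring.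
  by apply: lerD; [rewrite lerXn2r ?nnegrE ?(le_trans L0)|rewrite ler_wpM2l // mulr_ge0].
- by apply: IH => k kq; apply: Hq; rewrite ltnS ltnW.
Qed.

(** Both sides are squared norms, so [t] bounds the square of the operator norm. *)
Definition concentrated (t : R) (S : {set T}) :=
  forall x : 'cV[R]_D, fdot (dev S *m x) (dev S *m x) <= t * fdot x x.

Lemma concentrated_of_moment q t S : 0 <= t ->
  fdot (dev S ^+ q.+1) (dev S ^+ q.+1) <= t ^+ q.+1 -> concentrated t S.
Proof.
move=> t0 H x; rewrite -(@ler_pXn2r _ q.+1) ?nnegrE ?mulr_ge0 ?fdot_ge0 //.
apply: le_trans (fdot_iter_le _ _ (dev_sym S)) _; rewrite exprMn.
by apply: ler_wpM2r => //; apply: exprn_ge0; exact: fdot_ge0.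
Qed.

(** Markov's inequality in counting form. *)
Lemma card_not_concentrated q t : 0 <= t ->
  #|[set S : {set T} | (#|S| == m) &&
      (t ^+ q < fdot (dev S ^+ q) (dev S ^+ q))]|%:R * t ^+ q <= M q.
Proof.
move=> t0; rewrite mulr_natl -sumr_const /M.
under eq_bigl do rewrite inE.
rewrite [X in _ <= X](bigID (fun S => t ^+ q < fdot (dev S ^+ q) (dev S ^+ q))) /=.
rewrite -[X in X <= _]addr0; apply: lerD.
  by apply: ler_sum => S /andP[_ /ltW].
by apply: sumr_ge0 => S _; exact: fdot_ge0.
Qed.

End SampledGram.

(** * Eckart-Young and the factored landscape *)

Section EckartYoung.
Variable R : realFieldType.

Lemma gram_unitmx k n (B : 'M[R]_(k, n)) : row_free B -> B *m B^T \in unitmx.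
Proof.
move=> fB; rewrite -row_free_unit -kermx_eq0; set Z := kermx _.
have ZB : Z *m B *m B^T = 0 by rewrite -mulmxA mulmx_ker.
rewrite -(mulmx_free_eq0 _ fB) -fdot_eq0 fdot_mulr -(trmxK B) trmxK.
by rewrite ZB fdot0r.
Qed.

(** The explicit projection [B^T (B B^T)^-1 B]. Its last clause later factors the projection onto
    the column space of [V] through [V]. *)
Lemma proj_row_space k n (B : 'M[R]_(k, n)) : row_free B ->
  exists P : 'M[R]_n, [/\ P^T = P, P *m P = P, B *m P = B, \tr P = k%:R &
    exists Y, P = B^T *m Y].
Proof.
move=> fB; have uG := gram_unitmx fB.
have sG : (invmx (B *m B^T))^T = invmx (B *m B^T).
  by rewrite trmx_inv trmx_mul trmxK.
exists (B^T *m invmx (B *m B^T) *m B); split.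
- by rewrite !trmx_mul sG trmxK mulmxA.
- by rewrite !mulmxA -(mulmxA _ B) mulmxKV.
- by rewrite !mulmxA mulmxV // mul1mx.
- by rewrite mxtrace_mulC mulmxA mulmxV // mxtrace1.
- by exists (invmx (B *m B^T) *m B); rewrite mulmxA.
Qed.

Lemma fdot_cols m n (Z : 'M[R]_(m, n)) : fdot Z Z = \sum_j fdot (col j Z) (col j Z).
Proof.
rewrite fdotE exchange_big; apply: eq_bigr => j _; rewrite fdotE.
by apply: eq_bigr => i _; rewrite big_ord1 mxE.
Qed.

Lemma fdot_mulmx_le_columns m n k (W : 'M[R]_(m, n)) (Y : 'M[R]_(n, k)) s :
  (forall b : 'cV_n, fdot (W *m b) (W *m b) <= s * fdot b b) ->
  fdot (W *m Y) (W *m Y) <= s * fdot Y Y.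
Proof.
move=> Ws.
rewrite !fdot_cols mulr_sumr; apply: ler_sum => j _.
by rewrite colE -mulmxA -colE.
Qed.

Lemma fdot_projD m n (Z : 'M[R]_(m, n)) (P : 'M[R]_n) : P^T = P -> P *m P = P ->
  fdot Z Z = fdot (Z *m P) (Z *m P) + fdot (Z *m (1%:M - P)) (Z *m (1%:M - P)).
Proof.
move=> sP iP; rewrite mulmxBr mulmx1 fdotD2 fdotNr fdotNl fdotNr opprK.
have -> : fdot (Z *m P) (Z *m P) = fdot Z (Z *m P).
  by rewrite fdot_mulr sP -mulmxA iP.
ring.
Qed.

(* Ky Fan's argument: [s] separates the spectrum of [W^T W] from that of [X^T X] on the range of
   [Q], so no projection of rank at most [\tr Q] captures more of [X + W] than [Q] does. *)
Lemma eckart_young m n (X W M : 'M[R]_(m, n)) (Q : 'M[R]_n) s :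
  Q^T = Q -> Q *m Q = Q -> X *m Q = X -> W *m Q = 0 -> X^T *m W = 0 ->
  (\rank M)%:R <= \tr Q -> 0 <= s ->
  (forall b : 'cV_n, fdot (W *m b) (W *m b) <= s * fdot b b) ->
  (forall x : 'cV_n, s * fdot (Q *m x) (Q *m x) <= fdot (X *m x) (X *m x)) ->
  fdot W W <= fdot (X + W - M) (X + W - M).
Proof.
move=> sQ iQ XQ WQ XW rM s0 Ws Xs.
have [P [sP iP MP tP _]] := proj_row_space (row_base_free M).
have {}MP : M *m P = M.
  have /submxP[Y ->] : (M <= row_base M)%MS by rewrite eq_row_base.
  by rewrite -mulmxA MP.
have PP : fdot P P = (\rank M)%:R by rewrite /fdot sP iP.
have QQ : fdot Q Q = \tr Q by rewrite /fdot sQ iQ.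
pose P' : 'M[R]_n := 1%:M - P.
(* Pythagoras: the column spaces of [X] and [W] are orthogonal. *)
have XWP k (Y : 'M[R]_(n, k)) : fdot ((X + W) *m Y) ((X + W) *m Y) =
    fdot (X *m Y) (X *m Y) + fdot (W *m Y) (W *m Y).
  rewrite mulmxDl fdotD2 [X in 2 * X]fdot_mull mulmxA XW mul0mx fdot0r; ring.
have Z1 := fdot_projD (X + W - M) sP iP.
have Z2 : (X + W - M) *m P' = (X + W) *m P'.
  by rewrite mulmxBl [M *m P']mulmxBr mulmx1 MP subrr subr0.
rewrite -/P' Z2 XWP in Z1.
have W1 := fdot_projD W sP iP; rewrite -/P' in W1.
have XP : s * fdot (Q *m P') (Q *m P') <= fdot (X *m P') (X *m P').
  rewrite !fdot_cols mulr_sumr; apply: ler_sum => j _.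
  by rewrite !colE -!mulmxA; exact: Xs.
have WP : fdot (W *m P) (W *m P) <= s * fdot ((1%:M - Q) *m P) ((1%:M - Q) *m P).
  have -> : W *m P = W *m ((1%:M - Q) *m P) by rewrite mulmxA mulmxBr mulmx1 WQ subr0.
  exact: fdot_mulmx_le_columns.
have Q1 := fdot_projD Q sP iP; rewrite -/P' in Q1.
have Q2 : fdot P P = fdot (Q *m P) (Q *m P) + fdot ((1%:M - Q) *m P) ((1%:M - Q) *m P).
  rewrite -fdot_tr (fdot_projD _ sQ iQ) -fdot_tr -[X in _ + X]fdot_tr.
  by rewrite !trmx_mul !trmxK linearB /= trmx1 sQ.
have ZP := fdot_ge0 ((X + W - M) *m P).
(* [Q1], [Q2] and the traces give |Q P'|^2 - |(1 - Q) P|^2 = tr Q - rank M >= 0, so [XP] pays for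
   [WP]. *)
have : 0 <= s * (\tr Q - (\rank M)%:R) by rewrite mulr_ge0 // subr_ge0.
rewrite Z1 W1 -PP -QQ Q1 Q2; lra.
Qed.

End EckartYoung.

(** * Critical points without negative curvature *)

Section Landscape.
Variable R : realType.
Variables (d1 d2 r : nat).
Variables (U : 'M[R]_(d1, r)) (V : 'M[R]_(d2, r)) (M G : 'M[R]_(d1, d2)) (c : R).
Hypotheses (c0 : 0 < c) (GV : G *m V = 0) (UG : U^T *m G = 0).
Hypothesis curvature : forall (dU : 'M[R]_(d1, r)) (dV : 'M[R]_(d2, r)),
  0 <= c * fdot (dU *m V^T + U *m dV^T) (dU *m V^T + U *m dV^T) +
       2 * fdot G (dU *m dV^T).

Lemma discriminant_le (F : realFieldType) (a b d : F) :
  (forall x y, 0 <= a * x ^+ 2 + b * y ^+ 2 + 2 * d * (x * y)) -> d ^+ 2 <= a * b.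
Proof.
move=> H; have := H 1 0; have := H 0 1.
rewrite !expr0n !expr1n !(mulr0, mul0r, mulr1, addr0, add0r) => b0 a0.
have [b00|bn0] := eqVneq b 0.
  (* This point is chosen to make the form equal to [- d ^+ 2] when [b = 0]. *)
  rewrite b00 mulr0; have := H d ((- a - 1) / 2); rewrite b00.
  have -> : a * d ^+ 2 + 0 * ((- a - 1) / 2) ^+ 2 + 2 * d * (d * ((- a - 1) / 2))
    = - d ^+ 2 by field.
  by rewrite oppr_ge0.
have bp : 0 < b by rewrite lt0r bn0.
have := H b (- d).
have -> : a * b ^+ 2 + b * (- d) ^+ 2 + 2 * d * (b * - d) = b * (a * b - d ^+ 2) by ring.
by rewrite pmulr_rge0 // subr_ge0.
Qed.

(** Curvature along [dU = x G b y^T], [dV = t b z^T] is a quadratic form in [(x, t)], since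
    [U^T G = 0] kills the cross term of the square; the claim is its discriminant inequality. *)
Lemma curvature_rank1 (y z : 'cV[R]_r) (b : 'cV[R]_d2) :
  fdot y z ^+ 2 * fdot (G *m b) (G *m b) <=
  c ^+ 2 * fdot (V *m y) (V *m y) * fdot (U *m z) (U *m z) * fdot b b.
Proof.
have [->|Gb0] := eqVneq (G *m b) 0.
  rewrite fdot0l mulr0; do 3![apply: mulr_ge0; last exact: fdot_ge0].
  exact: sqr_ge0.
have Gbp : 0 < fdot (G *m b) (G *m b) by rewrite fdot_gt0.
set g := fdot (G *m b) (G *m b) in Gbp *.
suff : (fdot y z * g) ^+ 2 <=
    (c * (g * fdot (V *m y) (V *m y))) * (c * (fdot (U *m z) (U *m z) * fdot b b)).
  by move=> H; rewrite -(ler_pM2r Gbp); move: H; congr (_ <= _); ring.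
apply: discriminant_le => x t.
have := curvature (x *: (G *m b *m y^T)) (t *: (b *m z^T)).
rewrite fdotD2.
have -> : (x *: (G *m b *m y^T)) *m V^T = x *: (G *m b *m (V *m y)^T).
  by rewrite -scalemxAl trmx_mul !mulmxA.
have -> : U *m (t *: (b *m z^T))^T = t *: (U *m z *m b^T).
  by rewrite linearZ /= -scalemxAr trmx_mul trmxK mulmxA.
have -> : (x *: (G *m b *m y^T)) *m (t *: (b *m z^T))^T = (x * t * fdot y z) *: (G *m b *m b^T).
  rewrite linearZ /= -scalemxAr -scalemxAl scalerA trmx_mul trmxK !mulmxA.
  rewrite -(mulmxA _ y^T) mulmx_tr_col.
  by rewrite mul_mx_scalar -scalemxAl scalerA mulrC [t * x]mulrC mulrC.
rewrite !(fdotZl, fdotZr) !fdot_outer.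
rewrite (_ : fdot (G *m b *m (V *m y)^T) _ = 0); last first.
  by rewrite fdotC -mulmxA fdot_mull !mulmxA UG !mul0mx fdot0r.
rewrite [fdot G _]fdotC [fdot (G *m b *m b^T) G]fdot_mulr trmxK -/g.
by congr (0 <= _); ring.
Qed.

Lemma landscape_le : (\rank M <= r)%N ->
  2 * fdot G (U *m V^T - M) <= c * fdot (U *m V^T - M) (U *m V^T - M).
Proof.
move=> rM; set X := U *m V^T; set E := X - M.
(* If [V] is rank deficient, a nonzero [y] with [V y = 0], taken also as [z], makes the right-hand
   side of [curvature_rank1] vanish, whence [G = 0]. *)
have [fV|nfV] := boolP (row_free V^T); last first.
  suff -> : G = 0 by rewrite fdot0l mulr0 mulr_ge0 ?fdot_ge0 // ltW.
  move: nfV; rewrite -kermx_eq0 => /rowV0Pn[u /sub_kermxP uV u0].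
  have Vy : V *m u^T = 0 by rewrite -[V]trmxK -trmx_mul uV trmx0.
  have y0 : fdot u^T u^T != 0 by rewrite fdot_tr fdot_eq0.
  have Gb b : G *m b = 0 :> 'cV_d1.
    have := curvature_rank1 u^T u^T b; rewrite Vy fdot0l mulr0 !mul0r => H.
    apply/eqP; rewrite -fdot_eq0 eq_le fdot_ge0 andbT.
    by move: H; rewrite pmulr_rle0 // exprn_gt0 // lt0r y0 fdot_ge0.
  apply/matrixP => i j; have := Gb (delta_mx j 0); rewrite -colE => /colP/(_ i).
  by rewrite !mxE.
have [Q [sQ iQ VQ tQ [Y QY]]] := proj_row_space fV; rewrite trmxK in QY.
(* The supremum of [f] is the squared operator norm of [G]; at [b = 0] division by zero gives the
   harmless value 0. *)
pose f (b : 'cV[R]_d2) := fdot (G *m b) (G *m b) / fdot b b.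
have fle b : f b <= fdot G G.
  rewrite /f; have [->|b0] := eqVneq b 0; first by rewrite mulmx0 !fdot0l mul0r fdot_ge0.
  by rewrite ler_pdivrMr ?fdot_gt0 // fdot_mulmx_le.
pose S : set R := (range f)%classic.
have S0 : (S !=set0)%classic by exists (f 0), 0.
have Sub : has_ubound S by exists (fdot G G) => _ [b _ <-].
have s0 : 0 <= sup S.
  apply: le_trans (ub_le_sup Sub _); last by exists 0.
  by rewrite /f mulmx0 fdot0l mul0r.
have Gs (b : 'cV[R]_d2) : fdot (G *m b) (G *m b) <= sup S * fdot b b.
  have [->|b0] := eqVneq b 0; first by rewrite mulmx0 !fdot0l mulr0.
  by rewrite -ler_pdivrMr ?fdot_gt0 //; apply: ub_le_sup => //; exists b.
have Xs (x : 'cV[R]_d2) : sup S * fdot (Q *m x) (Q *m x) <= c ^+ 2 * fdot (X *m x) (X *m x).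
  have [->|w0] := eqVneq (Q *m x) 0.
    by rewrite fdot0l mulr0 mulr_ge0 ?fdot_ge0 ?sqr_ge0.
  have wp : 0 < fdot (Q *m x) (Q *m x) by rewrite fdot_gt0.
  rewrite -ler_pdivlMr //; apply: ge_sup => // _ [b _ <-].
  rewrite /f; have [->|b0] := eqVneq b 0.
    by rewrite mulmx0 !fdot0l mul0r divr_ge0 ?fdot_ge0 // mulr_ge0 ?fdot_ge0 ?sqr_ge0.
  rewrite ler_pdivrMr ?fdot_gt0 // mulrAC ler_pdivlMr //.
  (* Chosen so that [V y = Q x], [U z = X x] and <y, z> = |Q x|^2. *)
  have := curvature_rank1 (Y *m x) (V^T *m (Q *m x)) b.
  have -> : V *m (Y *m x) = Q *m x by rewrite mulmxA -QY.
  have -> : fdot (Y *m x) (V^T *m (Q *m x)) = fdot (Q *m x) (Q *m x).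
    by rewrite [LHS]fdotC [LHS]fdot_mull trmxK mulmxA -QY.
  have -> : U *m (V^T *m (Q *m x)) = X *m x by rewrite /X -!mulmxA (mulmxA V^T) VQ.
  move=> H; rewrite -(ler_pM2r wp); move: H; congr (_ <= _); ring.
have ci0 : 0 <= c^-1 by rewrite invr_ge0 ltW.
have := @eckart_young R d1 d2 X (- c^-1 *: G) M Q (c^-1 ^+ 2 * sup S) sQ iQ.
have -> : X *m Q = X by rewrite /X -mulmxA VQ.
have -> : (- c^-1 *: G) *m Q = 0 by rewrite QY -scalemxAl mulmxA GV mul0mx scaler0.
have -> : X^T *m (- c^-1 *: G) = 0.
  by rewrite -scalemxAr /X trmx_mul -mulmxA UG mulmx0 scaler0.
rewrite tQ ler_nat => /(_ erefl erefl erefl rM).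
move=> /(_ (mulr_ge0 (sqr_ge0 _) s0)) H.
have {}H : fdot (- c^-1 *: G) (- c^-1 *: G) <= fdot (X - c^-1 *: G - M) (X - c^-1 *: G - M).
  rewrite -[X in fdot (X - _)]/(X + - (c^-1 *: G)) -scaleNr; apply: H.
    move=> b; rewrite -scalemxAl fdotZl fdotZr mulrA -expr2 sqrrN -(mulrA _ (sup S)).
    by rewrite ler_wpM2l ?sqr_ge0.
  move=> x; rewrite -mulrA mulrC -ler_pdivlMr ?exprn_gt0 ?invr_gt0 //.
  by rewrite -exprVn invrK [X in _ <= X]mulrC; exact: Xs.
have EG : X - c^-1 *: G - M = E - c^-1 *: G by rewrite addrAC.
have {}H : 2 * (c^-1 * fdot G E) <= fdot E E.
  move: H; rewrite EG fdotD2 !(scaleNr, fdotNl, fdotNr, opprK) !(fdotZl, fdotZr) (fdotC E G).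
  by lra.
have -> : 2 * fdot G E = c * (2 * (c^-1 * fdot G E)) by field; rewrite gt_eqF.
by rewrite ler_pM2l.
Qed.

End Landscape.

(** * Gradient and Hessian of the objective *)

(** The spectral theorem is applied over the complex numbers: if every eigenvalue were nonnegative,
    so would be the quadratic form. *)
Lemma sym_neg_eigenvalue (R : rcfType) n (H : 'M[R]_n) (h : 'rV[R]_n) :
  H^T = H -> fdot (h *m H) h < 0 -> exists2 lam, lam < 0 & eigenvalue H lam.
Proof.
move=> sH hH; pose toC := real_complex R; pose A := map_mx toC H.
have hA : A \is hermsymmx.
  apply: realsym_hermsym.
    by apply/is_hermitianmxP; rewrite expr0 scale1r; apply/matrixP => i j; rewrite !mxE -{1}sH mxE.
  by apply/mxOverP => i j; rewrite mxE; apply/complex_realP; exists (H i j).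
have dR := hermitian_spectral_diag_real hA.
have /hermitian_normalmx /orthomx_spectralP := hA.
set P := spectralmx A in dR *; set d := spectral_diag A in dR * => AE.
have uP : P \is unitarymx by exact: spectral_unitarymx.
have [/existsP[i di]|] := boolP [exists i, d 0 i < 0].
  have /mxOverP/(_ 0 i)/complex_realP[k dk] := dR.
  exists k; first by move: di; rewrite dk (ltcR k 0).
  (* The eigenvalue returns to the real field as a root of the characteristic polynomial. *)
  rewrite eigenvalue_root_char -(fmorph_root toC) map_char_poly -eigenvalue_root_char.
  apply/eigenvalueP; exists (row i P).
    suff : row i P *m A = d 0 i *: row i P by rewrite dk.
    rewrite -row_mul AE !mulmxA mulmxV ?unitarymx_unit // mul1mx.
    apply/rowP => j; rewrite !mxE (bigD1 i) //= big1 ?addr0 ?mxE ?eqxx // => l /negPf il.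
    by rewrite mxE eq_sym il mul0r.
  apply/eqP => Pi0; have := mulmxK (unitarymx_unit uP) (delta_mx (0 : 'I_1) i).
  rewrite -rowE Pi0 mul0mx => /matrixP/(_ 0 i); rewrite !mxE !eqxx => /eqP.
  by rewrite eq_sym oner_eq0.
rewrite negb_exists => /forallP d0; exfalso.
pose y := map_mx toC h *m invmx P.
(* As [h] is real, the form becomes the sum of the [d 0 i] weighted by the squared moduli of the
   coordinates of [y]. *)
have yE : P *m (map_mx toC h)^T = (map_mx Num.conj y)^T.
  rewrite /y map_mxM trmx_mul invmx_unitary //; congr (_ *m _).
    apply/matrixP => i j; by rewrite !mxE; exact/esym/conjCK.
  apply/matrixP => i j; rewrite !mxE; apply/esym/CrealP/complex_realP.
  by exists (h j i).
have : toC (fdot (h *m H) h) < 0 by rewrite (ltcR _ 0).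
have -> : toC (fdot (h *m H) h) = \tr (map_mx toC h *m A *m (map_mx toC h)^T).
  by rewrite map_trmx -!map_mxM trace_map_mx.
rewrite AE !mulmxA -[_ *m diag_mx d *m P *m _]mulmxA yE -/y.
rewrite /mxtrace big_ord1 mxE le_gtF //.
apply: sumr_ge0 => i _; rewrite mul_mx_diag !mxE mulrAC.
apply: mulr_ge0; first exact: mul_conjC_ge0.
by have := d0 i; rewrite -real_leNgt ?real0 //; move/mxOverP: dR; apply.
Qed.

(** Along a line the objective is a polynomial of degree at most 4, so its derivative at 0 is read
    off as a coefficient. *)
Lemma derive1_quartic (R : realType) (f : R -> R) (a b c d e : R) :
  (forall t, f t = a + b * t + c * t ^+ 2 + d * t ^+ 3 + e * t ^+ 4) -> derive1 f 0 = b.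
Proof.
move=> fE; pose p : {poly R} := Poly [:: a; b; c; d; e].
have -> : f = horner p.
  by apply/funext => t; rewrite fE horner_Poly /=; ring.
by rewrite -derivE horner_coef0 coef_deriv coef_Poly.
Qed.

(** Passes from the coordinatewise gradient and Hessian to arbitrary directions. *)
Lemma linear_coordE (R : pzRingType) n (f : 'rV[R]_n -> R) (h : 'rV[R]_n) :
  (forall a u v, f (a *: u + v) = a * f u + f v) ->
  \sum_i h 0 i * f (delta_mx 0 i) = f h.
Proof.
move=> fL; have f0 : f 0 = 0.
  have /eqP := fL 1 0 0.
  by rewrite scaler0 addr0 mul1r -subr_eq0 opprD addNKr oppr_eq0 => /eqP.
rewrite [in RHS](row_sum_delta h).
elim/big_rec2: _ => [|i x u _ ->]; first by rewrite f0.
by rewrite fL.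
Qed.

(** * The objective as a quadratic form in the residual *)

Section FactoredLeastSquares.
Variables (R : realType) (n1 n2 d1 d2 r : nat) (Om : {set 'I_n1 * 'I_n2}).
Variables (A : 'M[R]_(n1, d1)) (B : 'M[R]_(n2, d2)) (M : 'M[R]_(d1, d2)).
Let N := (d1 * r + d2 * r)%N.

Definition sampled (E : 'M[R]_(d1, d2)) := P_Omega Om (A *m E *m B^T).
Definition sform (E E' : 'M[R]_(d1, d2)) := fdot (sampled E) (sampled E').

Lemma sampledD E E' : sampled (E + E') = sampled E + sampled E'.
Proof.
rewrite /sampled mulmxDr mulmxDl; apply/matrixP => i j; rewrite !mxE.
by case: ifP => _; rewrite ?addr0.
Qed.

Lemma sampledZ a E : sampled (a *: E) = a *: sampled E.
Proof.
rewrite /sampled -scalemxAr -scalemxAl; apply/matrixP => i j; rewrite !mxE.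
by case: ifP => _; rewrite ?mulr0.
Qed.

Let sformE := (sampledD, sampledZ, fdotDl, fdotDr, fdotZl, fdotZr).

Definition sgrad (E : 'M[R]_(d1, d2)) := A^T *m sampled E *m B.

Lemma sform_grad E Z : sform E Z = fdot (sgrad E) Z.
Proof.
rewrite /sgrad fdot_mulr fdot_mull trmxK mulmxA /sform !fdotE.
apply: eq_bigr => i _; apply: eq_bigr => j _.
by rewrite !mxE; case: ifP => _; rewrite ?mul0r.
Qed.

Let Uz (z : 'rV[R]_N) : 'M[R]_(d1, r) := vec_mx (lsubmx z).
Let Vz (z : 'rV[R]_N) : 'M[R]_(d2, r) := vec_mx (rsubmx z).
Let F z := Uz z *m (Vz z)^T - M.
(** The derivative of [F] at [z] along [h]; it is also a symmetric bilinear map in [z] and [h]. *)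
Let F1 z h := Uz h *m (Vz z)^T + Uz z *m (Vz h)^T.

Let UzL a u v : Uz (a *: u + v) = a *: Uz u + Uz v.
Proof. by rewrite /Uz !linearP. Qed.
Let VzL a u v : Vz (a *: u + v) = a *: Vz u + Vz v.
Proof. by rewrite /Vz !linearP. Qed.

Let F1C z h : F1 z h = F1 h z.
Proof. by rewrite /F1 addrC. Qed.

Let F1L z a u v : F1 z (a *: u + v) = a *: F1 z u + F1 z v.
Proof.
rewrite /F1 UzL VzL linearP /= mulmxDl mulmxDr -scalemxAl -scalemxAr scalerDr.
by rewrite addrACA.
Qed.

Let FE z h t : F (z + t *: h) = F z + t *: F1 z h + t ^+ 2 *: (Uz h *m (Vz h)^T).
Proof.
rewrite /F (addrC z) UzL VzL linearP /= mulmxDl !mulmxDr -!scalemxAl -!scalemxAr scalerA -expr2.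
rewrite /F1 scalerDr; apply/matrixP => i j; rewrite !mxE; ring.
Qed.

Variables (Y : 'M[R]_(n1, n2)).
Hypothesis YE : Y = sampled M.

Lemma gobjE (U : 'M[R]_(d1, r)) V : gobj Om A B Y U V = sform (U *m V^T - M) (U *m V^T - M).
Proof.
rewrite /gobj /sform sampledD -(scaleN1r M) sampledZ scaleN1r -YE /sampled !mulmxA fdotE.
by apply: eq_bigr => i _; apply: eq_bigr => j _; rewrite expr2.
Qed.

Lemma partial_gvec (z : 'rV[R]_N) i :
  partial (gvec Om A B Y) z i = 2 * sform (F z) (F1 z (delta_mx 0 i)).
Proof.
rewrite /partial; set e := delta_mx 0 i; pose F2 := Uz e *m (Vz e)^T.
apply: (@derive1_quartic _ _ (sform (F z) (F z)) _
  (sform (F1 z e) (F1 z e) + 2 * sform (F z) F2) (2 * sform (F1 z e) F2) (sform F2 F2)) => t.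
rewrite /gvec gobjE -/(Uz _) -/(Vz _) -/(F _) FE -/F2.
move: (F z) (F1 z e) F2 => a b c; rewrite /sform !sformE.
rewrite (fdotC (sampled b) (sampled a)) !(fdotC (sampled c)); ring.
Qed.

(** The second derivative: a Gauss-Newton term plus the curvature of the factorisation paired with
    the residual. *)
Definition hform z u v := 2 * (sform (F1 z u) (F1 z v) + sform (F z) (F1 u v)).

Lemma hessian_gvec (z : 'rV[R]_N) i j :
  hessian (gvec Om A B Y) z i j = hform z (delta_mx 0 i) (delta_mx 0 j).
Proof.
rewrite mxE.
have -> : (fun w => partial (gvec Om A B Y) w j) =
    (fun w => 2 * sform (F w) (F1 w (delta_mx 0 j))).
  by apply/funext => w; exact: partial_gvec.
rewrite /partial; set e := delta_mx 0 i; set e' := delta_mx 0 j; pose F2 := Uz e *m (Vz e)^T.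
(* A partial derivative is only cubic along a line, hence the final 0. *)
apply: (@derive1_quartic _ _ (2 * sform (F z) (F1 z e')) _
  (2 * (sform (F1 z e) (F1 e e') + sform F2 (F1 z e'))) (2 * sform F2 (F1 e e')) 0) => t.
rewrite FE -/F2 (F1C _ e') (addrC z) F1L (F1C e' z) (F1C e' e) /hform.
move: (F z) (F1 z e) (F1 z e') (F1 e e') F2 => a b c d f; rewrite /sform !sformE; ring.
Qed.

Lemma hform_sym z u v : hform z u v = hform z v u.
Proof. by rewrite /hform (F1C u v) /sform fdotC. Qed.

Lemma hformL z u a v w : hform z u (a *: v + w) = a * hform z u v + hform z u w.
Proof.
rewrite /hform !F1L; move: (F z) (F1 z u) (F1 z v) (F1 z w) (F1 u v) (F1 u w) => *.
rewrite /sform !sformE; ring.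
Qed.

Lemma hessian_form (z h : 'rV[R]_N) : fdot (h *m hessian (gvec Om A B Y) z) h = hform z h h.
Proof.
rewrite -(linear_coordE _ (fun a u v => hformL z h a u v)) fdotE big_ord1.
apply: eq_bigr => j _; rewrite mulrC mxE; congr (_ * _).
rewrite hform_sym -(linear_coordE _ (fun a u v => hformL z (delta_mx 0 j) a u v)).
by apply: eq_bigr => i _; rewrite hessian_gvec hform_sym.
Qed.

Lemma hessian_sym (z : 'rV[R]_N) : (hessian (gvec Om A B Y) z)^T = hessian (gvec Om A B Y) z.
Proof. by apply/matrixP => i j; rewrite mxE !hessian_gvec hform_sym. Qed.

Lemma gradient_eq0 (z h : 'rV[R]_N) : gradient (gvec Om A B Y) z = 0 -> sform (F z) (F1 z h) = 0.
Proof.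
move=> g0; rewrite -(@linear_coordE _ _ (fun h => sform (F z) (F1 z h))); last first.
  by move=> a u v; rewrite F1L; move: (F z) (F1 z u) (F1 z v) => *; rewrite /sform !sformE.
apply: big1 => i _; have /rowP/(_ i) := g0; rewrite !mxE partial_gvec => /eqP.
by rewrite mulf_eq0 pnatr_eq0 /= => /eqP->; rewrite mulr0.
Qed.

Variables (lo hi : R).
Hypotheses (hi0 : 0 < hi) (hilo : hi < 2 * lo).
Hypothesis sform_ge : forall E, lo * fdot E E <= sform E E.
Hypothesis sform_le : forall E, sform E E <= hi * fdot E E.
Hypothesis rankM : (\rank M <= r)%N.

(** Without a negative eigenvalue, [landscape_le] gives 2 <G, E> <= hi |E|^2, while <G, E> >= lo
    |E|^2; as [hi < 2 * lo], the residual [E] is 0. *)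
Lemma critical_point_dichotomy (U : 'M[R]_(d1, r)) (V : 'M[R]_(d2, r)) :
  gradient (gvec Om A B Y) (UVvec U V) = 0 ->
  ((forall (U' : 'M[R]_(d1, r)) (V' : 'M[R]_(d2, r)),
      gobj Om A B Y U V <= gobj Om A B Y U' V') /\ U *m V^T = M)
  \/ (exists2 lam : R, lam < 0 &
        eigenvalue (hessian (gvec Om A B Y) (UVvec U V)) lam).
Proof.
move=> g0; have [|nneg] := pselect (exists2 lam : R, lam < 0 &
  eigenvalue (hessian (gvec Om A B Y) (UVvec U V)) lam); first by right.
left; set z := UVvec U V in g0 nneg.
have UzK (W : 'M[R]_(d1, r)) (W' : 'M[R]_(d2, r)) : Uz (UVvec W W') = W.
  by rewrite /Uz row_mxKl mxvecK.
have VzK (W : 'M[R]_(d1, r)) (W' : 'M[R]_(d2, r)) : Vz (UVvec W W') = W'.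
  by rewrite /Vz row_mxKr mxvecK.
pose E := U *m V^T - M.
have FzE : F z = E by rewrite /F UzK VzK.
have F1E dU dV : F1 z (UVvec dU dV) = dU *m V^T + U *m dV^T by rewrite /F1 !UzK !VzK.
have dG dU dV : fdot (sgrad E) (dU *m V^T + U *m dV^T) = 0.
  by rewrite -sform_grad -FzE -F1E gradient_eq0.
(* The gradient is tested along [dU = G V], and below along [dV^T = U^T G]. *)
have GV : sgrad E *m V = 0.
  apply/eqP; rewrite -fdot_eq0; have := dG (sgrad E *m V) 0.
  by rewrite trmx0 mulmx0 addr0 fdotC fdot_mulr trmxK => ->.
have UG : U^T *m sgrad E = 0.
  apply/eqP; rewrite -fdot_eq0; have := dG 0 (U^T *m sgrad E)^T.
  by rewrite mul0mx add0r trmxK fdotC fdot_mull => ->.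
have curv (dU : 'M[R]_(d1, r)) (dV : 'M[R]_(d2, r)) :
    0 <= hi * fdot (dU *m V^T + U *m dV^T) (dU *m V^T + U *m dV^T) +
         2 * fdot (sgrad E) (dU *m dV^T).
  have : 0 <= hform z (UVvec dU dV) (UVvec dU dV).
    rewrite -hessian_form leNgt; apply/negP => /(sym_neg_eigenvalue (hessian_sym z)).
    exact: nneg.
  rewrite /hform FzE !F1E /F1 !UzK !VzK [X in _ + X]sform_grad fdotDr.
  have := sform_le (dU *m V^T + U *m dV^T); lra.
have := landscape_le hi0 GV UG curv rankM; rewrite -/E -sform_grad => Ele.
have E0 : E = 0.
  apply/eqP; rewrite -fdot_eq0 eq_le fdot_ge0 andbT.
  have := sform_ge E; rewrite -subr_ge0 => Ege.
  have : (2 * lo - hi) * fdot E E <= 0 by lra.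
  by rewrite pmulr_rle0 // subr_gt0.
split; last by apply/eqP; rewrite -subr_eq0 -/E E0.
by move=> U' V'; rewrite !gobjE -/E E0 /sform -(scale0r 0) sampledZ scale0r fdot0l fdot_ge0.
Qed.

End FactoredLeastSquares.

(** * Sampling entries *)

Lemma fdot_mxvec (R : realFieldType) m n (X Y : 'M[R]_(m, n)) :
  fdot (mxvec X) (mxvec Y) = fdot X Y.
Proof.
rewrite !fdotE big_ord1 pair_bigA /= (reindex _ (curry_mxvec_bij _ _)) /=.
by apply: eq_bigr => -[i j] _; rewrite !mxvecE.
Qed.

Lemma incoherent_isometryP (R : realType) (mu : R) m d (A : 'M[R]_(m, d)) :
  (0 < d)%N -> (0 < m)%N -> incoherent_isometry mu A ->
  0 < mu /\ forall i, fdot (row i A) (row i A) <= mu * d%:R / m%:R.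
Proof.
move=> d0 m0 [iA nA].
have rE i : fdot (row i A) (row i A) = \sum_j A i j ^+ 2.
  by rewrite fdotE big_ord1; apply: eq_bigr => j _; rewrite !mxE expr2.
have dm0 : 0 < d%:R / m%:R :> R by rewrite divr_gt0 ?ltr0n.
have mu0 : 0 < mu.
  (* The square root of a nonpositive number is 0, so [mu <= 0] would force [A = 0]. *)
  rewrite ltNge; apply/negP => mu0.
  have A0 : A = 0.
    apply/row_matrixP => i; rewrite row0; apply/eqP; rewrite -fdot_eq0 eq_le fdot_ge0 andbT.
    rewrite -sqrtr_eq0 rE eq_le sqrtr_ge0 andbT; apply: le_trans (nA i) _.
    by rewrite ler0_sqrtr // -mulrA pmulr_lle0.
  move: iA; rewrite /Defs.isometry A0 mulmx0 => /matrixP/(_ (Ordinal d0) (Ordinal d0)).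
  by rewrite !mxE eqxx => /esym/eqP; rewrite oner_eq0.
split=> // i; rewrite rE -ler_sqrt; first exact: nA.
by rewrite -mulrA; apply/ltW/mulr_gt0.
Qed.

Section EntrySampling.
Variables (R : realType) (n1 n2 d1 d2 : nat).
Variables (A : 'M[R]_(n1, d1)) (B : 'M[R]_(n2, d2)).

Definition entry_vec (e : 'I_n1 * 'I_n2) : 'cV[R]_(d1 * d2) :=
  (mxvec ((row e.1 A)^T *m row e.2 B))^T.

Lemma fdot_entry_vec e (E : 'M[R]_(d1, d2)) :
  fdot (entry_vec e) (mxvec E)^T = (A *m E *m B^T) e.1 e.2.
Proof.
rewrite /entry_vec fdot_tr fdot_mxvec fdot_mull trmxK fdotC fdotE big_ord1.
rewrite -row_mul mxE; apply: eq_bigr => k _; by rewrite !mxE.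
Qed.

Lemma entry_vec_norm e : fdot (entry_vec e) (entry_vec e) =
  fdot (row e.1 A) (row e.1 A) * fdot (row e.2 B) (row e.2 B).
Proof.
rewrite /entry_vec fdot_tr fdot_mxvec.
have := fdot_outer 1%:M (row e.1 A)^T (row e.2 B)^T.
by rewrite !mul1mx !trmxK !fdot_tr.
Qed.

(** Entrywise, the sum over pairs factors into an entry of [A^T A] times an entry of [B^T B]. *)
Lemma entry_vec_tight : Defs.isometry A -> Defs.isometry B ->
  \sum_e entry_vec e *m (entry_vec e)^T = 1%:M.
Proof.
move=> iA iB; apply/matrixP => k l; rewrite summxE.
case/mxvec_indexP: k => p q; case/mxvec_indexP: l => p' q'.
have -> : (1%:M : 'M[R]_(d1 * d2)) (mxvec_index p q) (mxvec_index p' q') =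
    (A^T *m A) p p' * (B^T *m B) q q'.
  rewrite iA iB !mxE /mxvec_index (inj_eq (@cast_ord_inj _ _ _)) (inj_eq enum_rank_inj).
  by rewrite xpair_eqE -mulnb natrM.
rewrite !mxE big_distrlr /= pair_bigA; apply: eq_bigr => -[i j] _.
by rewrite !mxE big_ord1 !mxE !mxvecE !mxE !big_ord1 !mxE mulrACA.
Qed.

Lemma sform_gram (S : {set 'I_n1 * 'I_n2}) (E : 'M[R]_(d1, d2)) :
  sform S A B E E = fdot (gram entry_vec S *m (mxvec E)^T) (mxvec E)^T.
Proof.
rewrite /gram mulmx_suml fdot_suml /sform fdotE pair_bigA /= [RHS]big_mkcond /=.
apply: eq_bigr => -[i j] _; rewrite [P_Omega _ _ _ _]mxE.
case: ifP => _; last by rewrite mul0r.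
rewrite -[in RHS]mulmxA fdot_mull fdotE !big_ord1.
by rewrite mulmx_tr_col [in RHS]mxE eqxx mulr1n fdot_entry_vec.
Qed.

(** Cauchy-Schwarz turns the operator norm bound on [dev] into a bound on its quadratic form. *)
Lemma sform_concentrated m (S : {set 'I_n1 * 'I_n2}) (E : 'M[R]_(d1, d2)) (s : R) :
  0 <= s -> concentrated m entry_vec (s ^+ 2) S ->
  `|sform S A B E E - m%:R / (n1 * n2)%:R * fdot E E| <= s * fdot E E.
Proof.
move=> s0 cS; set x := (mxvec E)^T.
have xE : fdot x x = fdot E E by rewrite fdot_tr fdot_mxvec.
have -> : sform S A B E E - m%:R / (n1 * n2)%:R * fdot E E = fdot (dev m entry_vec S *m x) x.
  rewrite /dev mulmxBl fdotDl fdotNl mul_scalar_mx fdotZl xE sform_gram.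
  by rewrite card_prod !card_ord.
rewrite -(@ler_pXn2r _ 2) ?nnegrE ?mulr_ge0 ?fdot_ge0 // real_normK ?num_real //.
apply: le_trans (fdot_CS _ _) _; rewrite exprMn expr2 -[in X in _ <= X]xE mulrA.
by rewrite xE; apply: ler_wpM2r; [exact: fdot_ge0|rewrite -xE; exact: cS].
Qed.

End EntrySampling.

(** * Failure probability and numerical constants *)

Lemma unif_subset_prob_ge (R : realType) (T : finType) m (P : {set T} -> Prop)
    (bad : pred {set T}) (eps : R) : (m <= #|T|)%N ->
  (forall S : {set T}, #|S| = m -> ~~ bad S -> P S) ->
  #|[set S : {set T} | (#|S| == m) && bad S]|%:R <=
    eps * #|[set S : {set T} | #|S| == m]|%:R ->
  1 - eps <= unif_subset_prob R m P.
Proof.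
move=> mT goodP badle; rewrite /unif_subset_prob.
set good := [set S | _ && `[< _ >]]; set all := [set S : {set T} | #|S| == m] in badle *.
(* By [m <= #|T|] there are subsets of size [m], so the quotient is a genuine one. *)
have all0 : 0 < #|all|%:R :> R.
  by rewrite ltr0n /all card_draws bin_gt0.
rewrite ler_pdivlMr // mulrBl mul1r lerBlDr; apply: le_trans (lerD (lexx _) badle).
set badm := [set S | _ && bad S]; rewrite -natrD ler_nat.
have sub : all \subset good :|: badm; last first.
  by apply: leq_trans (subset_leq_card sub) _; rewrite cardsU leq_subr.
apply/fintype.subsetP => S; rewrite !inE => Sm; rewrite Sm /=.
by case: (boolP (bad S)) => [|nb]; rewrite ?orbT // orbF; apply/asboolP/goodP => //; exact/eqP.
Qed.

Lemma unif_subset_prob_ge0 (R : realType) (T : finType) m (P : {set T} -> Prop) :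
  0 <= unif_subset_prob R m P.
Proof. by rewrite divr_ge0. Qed.

Lemma ln_ge_half (R : realType) (n : nat) : (1 < n)%N -> 1 <= 2 * ln n%:R :> R.
Proof.
move=> n1; have : ln (1 + - 2^-1) <= - 2^-1 :> R by apply: le_ln1Dx; lra.
have -> : 1 + - 2^-1 = 2^-1 :> R by field.
rewrite lnV ?posrE //; have : ln 2 <= ln n%:R :> R.
  by rewrite ler_ln ?posrE ?ltr0n ?ler_nat // (ltn_trans _ n1).
lra.
Qed.

(** With [e = expR (-2)] and [eta = e / 100], each moment step contributes at most [e] times the
    squared level [(p / 4) ^+ 2]. *)
Lemma tail_constant (R : realFieldType) (e : R) : 0 < e -> e <= 1 ->
  (e / 100) ^+ 2 + 4 * (e / 100) <= e / 16.
Proof. by move=> e0 e1; nra. Qed.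

(* Markov's inequality for the moment of order [2 (q + 1)], with [q] the integer part of [2 ln n],
   at the deviation level [p / 4]. *)
Lemma card_not_concentrated_small (R : realType) (T : finType) (D m n : nat)
    (v : T -> 'cV[R]_D) (K : R) :
  \sum_e v e *m (v e)^T = 1%:M -> (forall e, fdot (v e) (v e) <= K) ->
  (0 < m)%N -> (0 < #|T|)%N -> (1 < n)%N -> (D <= n ^ 2)%N ->
  16 * ln n%:R * K <= expR (-2) / 100 * (m%:R / #|T|%:R) ->
  exists q, #|[set S : {set T} | (#|S| == m) &&
      (((m%:R / #|T|%:R / 4) ^+ 2) ^+ q.+1 < fdot (dev m v S ^+ q.+1) (dev m v S ^+ q.+1))]|%:R
    <= n%:R ^- 2 * #|[set S : {set T} | #|S| == m]|%:R :> R.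
Proof.
have order_le (x y z : R) : 1 <= 2 * x -> y <= 2 * x -> z <= y * 2 + 1 -> 2 * z <= 16 * x by lra.
have expo_le (x y : R) : 2 * x < y -> y * - 2 <= - (4 * x) by lra.
have swapR (x y z c w : R) : x * z * (c * y) <= w * (c * y) -> x * y * (c * z) <= w * c * y.
  by congr (_ <= _); ring.
move=> vt vK m0 T0 n1 Dn HK; set p : R := m%:R / #|T|%:R in HK *.
have p0 : 0 < p by rewrite divr_gt0 ?ltr0n.
have n0 : 0 < n%:R :> R by rewrite ltr0n (ltn_trans _ n1).
have lnn := ln_ge_half R n1.
set l : R := ln n%:R in lnn HK.
pose q := Num.truncn (2 * l); exists q.
have K0 := bound_ge0 vK T0.
have l20 : 0 <= 2 * l by lra.
have /andP[ql lq] := truncn_itv l20; rewrite -/q in ql lq.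
set t := (p / 4) ^+ 2; have t0 : 0 < t by rewrite exprn_gt0 // divr_gt0.
have tq0 : 0 < t ^+ q.+1 by rewrite exprn_gt0.
have e0 : 0 < expR (-2) :> R by exact: expR_gt0.
have e1 : expR (-2) <= 1 :> R by rewrite -[X in _ <= X]expR0 ler_expR oppr_le0.
pose eta : R := expR (-2) / 100.
have eta0 : 0 < eta by rewrite divr_gt0.
(* Here [2 * (2k + 1) <= 8 * l + 2 <= 16 * l], because [1 <= 2 * l]. *)
have Hk k : (k < q.+1)%N -> 2 * k.*2.+1%:R * K <= eta * p.
  move=> kq; apply: le_trans HK; apply: ler_wpM2r => //.
  have : (k.*2.+1)%:R <= (q.*2.+1)%:R :> R by rewrite ler_nat ltnS leq_double.
  rewrite -(addn1 q.*2) -(muln2 q) natrD natrM.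
  exact: order_le.
rewrite -(ler_pM2r tq0).
apply: le_trans (card_not_concentrated m v q.+1 (ltW t0)) _.
apply: le_trans (moment_bound vt vK T0 Hk) _.
have etat : (eta ^+ 2 + 4 * eta) * p ^+ 2 <= expR (-2) * t.
  have -> : t = p ^+ 2 / 16 by rewrite /t; field.
  rewrite [X in _ <= X]mulrCA [X in _ <= X]mulrC; apply: ler_wpM2r; first exact: sqr_ge0.
  exact: tail_constant.
have base0 : 0 <= (eta ^+ 2 + 4 * eta) * p ^+ 2.
  by rewrite mulr_ge0 ?sqr_ge0 // addr_ge0 ?sqr_ge0 // mulr_ge0 // ltW.
rewrite -/p; set c : R := #|[set S : {set T} | #|S| == m]|%:R; have c0 : 0 <= c by [].
have D0 : 0 <= D%:R :> R by [].
apply: (@le_trans _ _ ((expR (-2) * t) ^+ q.+1 * (c * D%:R))).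
  apply: ler_wpM2r; first exact: mulr_ge0.
  by rewrite lerXn2r ?nnegrE // mulr_ge0 // ltW.
(* Since [q + 1 > 2 * l], the factor is at most [n ^- 4]; the dimension [D <= n ^ 2] costs two of
   these powers. *)
have eq : expR (-2) ^+ q.+1 <= n%:R ^- 4 :> R.
  rewrite -expRM_natl -[X in X ^- 4](lnK (n0 : _ \is Num.pos)) -expRM_natl -expRN ler_expR -/l.
  exact: expo_le.
have Dn2 : D%:R <= n%:R ^+ 2 :> R by rewrite -natrX ler_nat.
have key : expR (-2) ^+ q.+1 * D%:R <= n%:R ^- 2 :> R.
  apply: (@le_trans _ _ (n%:R ^- 4 * n%:R ^+ 2)).
    by apply: ler_pM => //; rewrite exprn_ge0 // ltW.
  by rewrite (exprD _ 2 2) invfM mulfVK // gt_eqF // exprn_gt0.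
rewrite exprMn; apply: swapR.
exact: ler_wpM2r (mulr_ge0 c0 (ltW tq0)) _ _ key.
Qed.

Theorem theorem3p1 (R : realType) :
  exists C : R, 0 < C /\
  forall (n1 n2 d1 d2 r : nat) (mu : R)
         (A : 'M[R]_(n1, d1)) (B : 'M[R]_(n2, d2)) (Xs : 'M[R]_(n1, n2)) (m : nat),
    (0 < r)%N -> (r <= d1)%N -> (d1 <= n1)%N -> (r <= d2)%N -> (d2 <= n2)%N ->
    incoherent_isometry mu A -> incoherent_isometry mu B ->
    \rank Xs = r ->
    (Xs^T <= A^T)%MS ->   (* column space of X* inside span of columns of A *)
    (Xs <= B^T)%MS ->     (* row space of X* inside span of columns of B *)
    (m <= n1 * n2)%N ->
    C * mu ^+ 2 * d1%:R * d2%:R * ln (maxn n1 n2)%:R <= m%:R ->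
    1 - 2 * ((maxn n1 n2)%:R ^- 2) <=
    unif_subset_prob R m (fun Om : {set 'I_n1 * 'I_n2} =>
      let Y := P_Omega Om Xs in
      forall (U : 'M[R]_(d1, r)) (V : 'M[R]_(d2, r)),
        gradient (gvec Om A B Y) (UVvec U V) = 0 ->
        ((forall (U' : 'M[R]_(d1, r)) (V' : 'M[R]_(d2, r)),
             gobj Om A B Y U V <= gobj Om A B Y U' V')
          /\ U *m V^T = A^T *m Xs *m B)
        \/ (exists2 lam : R, lam < 0 &
              eigenvalue (hessian (gvec Om A B Y) (UVvec U V)) lam)).
Proof.
(* This constant turns the lower bound on [m] into the hypothesis on [K] of
   [card_not_concentrated_small]. *)
exists (16 / (expR (-2) / 100)); split.
  by rewrite divr_gt0 // divr_gt0 // expR_gt0.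
move=> n1 n2 d1 d2 r mu A B Xs m r0 rd1 dn1 rd2 dn2 hA hB rX XA XB mN mC.
have [d10 d20] : (0 < d1)%N /\ (0 < d2)%N by lia.
have [n10 n20] : (0 < n1)%N /\ (0 < n2)%N by lia.
set n := maxn n1 n2 in mC *.
(* For [n = 1] the claimed probability bound is negative. *)
have [n1'|n1'] := leqP n 1.
  apply: le_trans (unif_subset_prob_ge0 _ _ _).
  have -> : n = 1%N by rewrite /n in n1' *; lia.
  by rewrite expr1n invr1; lra.
have [mu0 An] := incoherent_isometryP d10 n10 hA.
have [_ Bn] := incoherent_isometryP d20 n20 hB.
have [[iA _] [iB _]] := (hA, hB).
have cT : #|{: 'I_n1 * 'I_n2}| = (n1 * n2)%N by rewrite card_prod !card_ord.
have N0 : (0 < n1 * n2)%N by rewrite muln_gt0 n10.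
pose K : R := mu ^+ 2 * d1%:R * d2%:R / (n1 * n2)%:R.
have vK e : fdot (entry_vec A B e) (entry_vec A B e) <= K.
  rewrite entry_vec_norm.
  have -> : K = (mu * d1%:R / n1%:R) * (mu * d2%:R / n2%:R).
    by rewrite /K natrM; field; rewrite !pnatr_eq0 -!lt0n n10 n20.
  by apply: ler_pM => //; exact: fdot_ge0.
have e0 : 0 < expR (-2) / 100 :> R by rewrite divr_gt0 // expR_gt0.
have ln0 : 0 < ln n%:R :> R by have := ln_ge_half R n1'; lra.
have m0 : (0 < m)%N.
  rewrite -(ltr0n R); apply: lt_le_trans mC.
  by rewrite !mulr_gt0 ?exprn_gt0 ?invr_gt0 ?ltr0n // expR_gt0.
have HK : 16 * ln n%:R * K <= expR (-2) / 100 * (m%:R / #|{: 'I_n1 * 'I_n2}|%:R).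
  rewrite cT /K !mulrA ler_pM2r ?invr_gt0 ?ltr0n //.
  rewrite -ler_pdivrMl //; move: mC; congr (_ <= _); field.
  by rewrite gt_eqF // expR_gt0.
have T0 : (0 < #|{: 'I_n1 * 'I_n2}|)%N by rewrite cT.
have Dn : (d1 * d2 <= n ^ 2)%N.
  by rewrite -mulnn leq_mul // /n leq_max ?dn1 ?dn2 ?orbT.
have tight := entry_vec_tight iA iB.
have [q qP] := card_not_concentrated_small tight vK m0 T0 n1' Dn HK.
set p : R := m%:R / #|{: 'I_n1 * 'I_n2}|%:R in qP.
have p0 : 0 < p by rewrite divr_gt0 ?ltr0n.
apply: (unif_subset_prob_ge (bad := fun S =>
  ((p / 4) ^+ 2) ^+ q.+1 <
    fdot (dev m (entry_vec A B) S ^+ q.+1) (dev m (entry_vec A B) S ^+ q.+1))).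
- by rewrite cT.
- move=> S _; rewrite -leNgt => Sgood Y U V.
  have cS := concentrated_of_moment (sqr_ge0 (p / 4)) Sgood.
  have XE : Xs = A *m (A^T *m Xs *m B) *m B^T.
    have AX : A *m (A^T *m Xs) = Xs.
      case/submxP: XA => Z /(congr1 trmx); rewrite trmxK trmx_mul trmxK => ->.
      by rewrite (mulmxA A^T) iA mul1mx.
    have BX : Xs *m B *m B^T = Xs.
      by case/submxP: XB => Z ->; rewrite -(mulmxA Z) iB mulmx1.
    by rewrite -mulmxA -(mulmxA A^T) -mulmxA BX AX.
  (* Deviation at most [p / 4] gives these two constants, and 5/4 < 2 * 3/4. *)
  apply: (@critical_point_dichotomy _ _ _ _ _ _ S A B _ _ _ (3 / 4 * p) (5 / 4 * p)).
  + by rewrite /sampled -XE.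
  + by rewrite mulr_gt0.
  + lra.
  + move=> E; have := sform_concentrated E (ltW (divr_gt0 p0 (ltr0n _ 4))) cS.
    by rewrite -cT -/p ler_norml => /andP[+ _]; lra.
  + move=> E; have := sform_concentrated E (ltW (divr_gt0 p0 (ltr0n _ 4))) cS.
    by rewrite -cT -/p ler_norml => /andP[_ +]; lra.
  + rewrite -rX; apply: leq_trans (mxrankM_maxl _ _) _; exact: mxrankM_maxr.
(* The failure bound [n ^- 2] is relaxed to [2 * n ^- 2]. *)
- apply: le_trans qP _; apply: ler_wpM2r => //.
  by rewrite ler_peMl // ler1n.
Qed.
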